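(* Let $X$ be a finite alphabet and $u,v\in X^*$. If $\mathrm{hypo}(\mathcal{C}_2)$ satisfies the identity $u=v$, then: (1) $|u|_x=|v|_x$ for all $x\in X$; (2) for each $x\in X$, if $u=u_1xu_2$ and $v=v_1xv_2$ with $u_1,u_2,v_1,v_2\in X^*$ and $|u_1|_x=|v_1|_x=0$, then $|u_1|_y=|v_1|_y$ for all $y\in X$; (3) for each $x\in X$, if $u=u_1xu_2$ and $v=v_1xv_2$ with $u_1,u_2,v_1,v_2\in X^*$ and $|u_2|_x=|v_2|_x=0$, then $|u_2|_y=|v_2|_y$ for all $y\in X$.
   Context: $|w|_a$ denotes the number of occurrences of the letter $a$ in the word $w$. A monoid $M$ satisfies the identity $u=v$ ($u,v\in X^*$) if $\phi(u)=\phi(v)$ for every monoid homomorphism $\phi:X^*\to M$. Let $C_2=\{1<2<\bar2<\bar1\}$ and $C_2^*$ the free monoid over it; the symbol $3$ and $\bar3$ never occur. For $i\in\{1,2\}$, $w$ has an $i$-inversion if $w=w_1xw_2yw_3$ with $x\in\{i,\overline{i+1}\}$, $y\in\{i+1,\bar i\}$ (so a $2$-inversion means $w=w_12w_2\bar2w_3$). Quasi-crystal structure on $C_2^*$: $\mathrm{wt}(w)=(|w|_1-|w|_{\bar1},|w|_2-|w|_{\bar2})$. For $i\in\{1,2\}$: if $w$ has an $i$-inversion then $\ddot{\varepsilon}_i(w)=\ddot{\varphi}_i(w)=+\infty$ and $\ddot{e}_i(w),\ddot{f}_i(w)$ are undefined; otherwise $\ddot{\varepsilon}_i(w)=|w|_{i+1}+|w|_{\bar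 i}$, $\ddot{\varphi}_i(w)=|w|_i+|w|_{\overline{i+1}}$; $\ddot{e}_i(w)$ is defined iff $\ddot{\varepsilon}_i(w)>0$ and is obtained by replacing the right-most letter of $w$ in $\{i+1,\bar i\}$ by its image ($\ddot{e}_1:2\mapsto1,\bar1\mapsto\bar2$; $\ddot{e}_2:\bar2\mapsto2$); $\ddot{f}_i(w)$ is defined iff $\ddot{\varphi}_i(w)>0$ and is obtained by replacing the left-most letter of $w$ in $\{i,\overline{i+1}\}$ by its image ($\ddot{f}_1:1\mapsto2,\bar2\mapsto\bar1$; $\ddot{f}_2:2\mapsto\bar2$). The connected component $C_2^*(w)$ is the set of words obtained from $w$ by finitely many (defined) applications of these operators. Hypoplactic congruence: $u\ddot{\sim}v$ iff there is a bijection $\psi:C_2^*(u)\to C_2^*(v)$ with $\psi(u)=v$ preserving $\mathrm{wt},\ddot{\varepsilon}_i,\ddot{\varphi}_i$ and such that $\ddot{e}_i(\psi(x))$ is defined iff $\ddot{e}_i(x)$ is (then $\psi(\ddot{e}_i(x))=\ddot{e}_i(\psi(x))$), likewise for $\ddot{f}_i$. It is a monoid congruence; $\mathrm{hypo}(\mathcal{C}_2)=C_2^*/\ddot{\sim}$. *)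

(* Defs.v *)
From HB Require Import structures.
From mathcomp Require Import all_boot all_order all_algebra generic_quotient.
From mathcomp Require Import boolp classical_sets functions constructive_ereal.

Set Implicit Arguments.
Unset Strict Implicit.
Unset Printing Implicit Defensive.

Import GRing.Theory Num.Theory.

HB.instance Definition _ (X : choiceType) :=
  isMonoid.Build (seq X) (@catA X) (@cat0s X) (@cats0 X).

Definition satisfies_identity (M : monoidType) (X : finType) (u v : seq X)
    : Prop :=
  forall phi : seq X -> M, monoid.monoid_morphism phi -> phi u = phi v.

(* C_2 = {1 < 2 < bar 2 < bar 1}; lb n stands for bar n.  The order plays no
   role in the definitions below. *)
Inductive letter : Type := l1 | l2 | lb2 | lb1.

Definition nat_of_letter (a : letter) : nat :=
  match a with l1 => 0 | l2 => 1 | lb2 => 2 | lb1 => 3 end.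

Definition letter_of_nat (n : nat) : letter :=
  match n with 0 => l1 | 1 => l2 | 2 => lb2 | _ => lb1 end.

Lemma nat_of_letterK : cancel nat_of_letter letter_of_nat.
Proof. by case. Qed.

HB.instance Definition _ := Countable.copy letter (can_type nat_of_letterK).

Definition word : Type := seq letter.

Inductive index : Type := i1 | i2.

(* x \in {i, bar (i+1)}, where bar 3 does not occur. *)
Definition in_pos (i : index) (x : letter) : bool :=
  match i with
  | i1 => x \in [:: l1; lb2]
  | i2 => x \in [:: l2]
  end.

(* y \in {i+1, bar i}, where 3 does not occur. *)
Definition in_neg (i : index) (y : letter) : bool :=
  match i with
  | i1 => y \in [:: l2; lb1]
  | i2 => y \in [:: lb2]
  end.

Definition has_inversion (i : index) (w : word) : Prop :=
  exists (w1 w2 w3 : word) (x y : letter),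
    [/\ w = w1 ++ x :: w2 ++ y :: w3, in_pos i x & in_neg i y].

Definition wt (w : word) : int * int :=
  (((count_mem l1 w)%:Z - (count_mem lb1 w)%:Z)%R,
   ((count_mem l2 w)%:Z - (count_mem lb2 w)%:Z)%R).

Definition eps (i : index) (w : word) : \bar int :=
  if `[< has_inversion i w >] then +oo%E else ((count (in_neg i) w)%:Z)%:E.

Definition phi (i : index) (w : word) : \bar int :=
  if `[< has_inversion i w >] then +oo%E else ((count (in_pos i) w)%:Z)%:E.

(* Images of the letters under e_i and f_i; only the values on in_neg i,
   resp. in_pos i, are ever used. *)
Definition e_letter (i : index) (a : letter) : letter :=
  match i, a with
  | i1, l2 => l1 | i1, lb1 => lb2
  | i2, lb2 => l2
  | _, _ => a
  end.

Definition f_letter (i : index) (a : letter) : letter :=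
  match i, a with
  | i1, l1 => l2 | i1, lb2 => lb1
  | i2, l2 => lb2
  | _, _ => a
  end.

Fixpoint replace_first (p : pred letter) (g : letter -> letter) (w : word)
    : word :=
  if w is a :: w' then
    if p a then g a :: w' else a :: replace_first p g w'
  else [::].

Definition replace_last (p : pred letter) (g : letter -> letter) (w : word)
    : word := rev (replace_first p g (rev w)).

(* None means undefined. *)
Definition e_op (i : index) (w : word) : option word :=
  if ~~ `[< has_inversion i w >] && (0 < eps i w)%E
  then Some (replace_last (in_neg i) (e_letter i) w) else None.

Definition f_op (i : index) (w : word) : option word :=
  if ~~ `[< has_inversion i w >] && (0 < phi i w)%E
  then Some (replace_first (in_pos i) (f_letter i) w) else None.

Inductive component (w : word) : word -> Prop :=
| component_refl : component w w
| component_e i x y : component w x -> e_op i x = Some y -> component w y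
| component_f i x y : component w x -> f_op i x = Some y -> component w y.

(* The bijection is given by a map on all words, of which only the values on
   component u matter.  The equations on e_op and f_op say at once that
   both sides are simultaneously defined and that the values correspond. *)
Definition preserves_structure (u : word) (psi : word -> word) : Prop :=
  forall x, component u x ->
    wt (psi x) = wt x /\
    forall i, [/\ eps i (psi x) = eps i x, phi i (psi x) = phi i x,
                  e_op i (psi x) = omap psi (e_op i x) &
                  f_op i (psi x) = omap psi (f_op i x)].

Definition hypo_cong (u v : word) : Prop :=
  exists psi : word -> word,
    [/\ set_bij (component u) (component v) psi, psi u = v &
        preserves_structure u psi].

Lemma hypo_cong_intro u v psi : set_inj (component u) psi ->
  psi u = v -> preserves_structure u psi -> hypo_cong u v.
Proof.
move=> inj uv pres; exists psi; split=> //; split=> //.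
- move=> x; elim=> [|i {}x y cx + ey|i {}x y cx + ey].
  + by rewrite uv; apply: component_refl.
  + move=> cpx; apply: (component_e (i := i) cpx); have [_ /(_ i) [_ _ -> _]] := pres x cx.
    by rewrite ey.
  + move=> cpx; apply: (component_f (i := i) cpx); have [_ /(_ i) [_ _ _ ->]] := pres x cx.
    by rewrite ey.
- move=> y; elim=> [|i _ z _ [x cx <-]|i _ z _ [x cx <-]].
  + by exists u => //; apply: component_refl.
  + have [_ /(_ i) [_ _ -> _]] := pres x cx.
    case ex: e_op => [x'|] //= [<-]; exists x' => //.
    exact: component_e cx ex.
  + have [_ /(_ i) [_ _ _ ->]] := pres x cx.
    case ex: f_op => [x'|] //= [<-]; exists x' => //.
    exact: component_f cx ex.
Qed.

Lemma hypo_cong_refl u : hypo_cong u u.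
Proof.
apply: (@hypo_cong_intro _ _ id) => // x _; split=> // i.
by split=> //; [case: e_op|case: f_op].
Qed.

Lemma hypo_cong_trans u v w : hypo_cong u v -> hypo_cong v w -> hypo_cong u w.
Proof.
move=> [p [[pf pinj _] pu pp]] [q [[_ qinj _] qv qp]].
apply: (@hypo_cong_intro _ _ (q \o p)) => [x y cx cy /= exy||x cx].
- apply: pinj => //; apply: qinj => //; apply/mem_set/pf.
  + exact: set_mem cx.
  + exact: set_mem cy.
- by rewrite /= pu.
have [w1 s1] := pp x cx; have [w2 s2] := qp _ (pf _ cx).
rewrite /= w2 w1; split=> // i.
have [-> -> -> ->] := s2 i; have [-> -> -> ->] := s1 i.
by split=> //; [case: e_op|case: f_op].
Qed.

Lemma hypo_cong_sym u v : hypo_cong u v -> hypo_cong v u.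
Proof.
move=> [p [[pf pinj psurj] pu pp]].
have gE y : exists x, component v y -> component u x /\ p x = y.
  have [cy|ncy] := pselect (component v y); last by exists y.
  by have [x cx <-] := psurj y cy; exists x.
have {gE} [g gP] := choice gE.
have pK x : component u x -> g (p x) = x.
  move=> cx; have [cg pg] := gP _ (pf _ cx).
  by apply: pinj => //; apply/mem_set.
apply: (@hypo_cong_intro _ _ g) => [x y|| y cy].
- move=> /set_mem/gP[_ ex] /set_mem/gP[_ ey] exy.
  by rewrite -ex -ey exy.
- by rewrite -pu pK //; apply: component_refl.
have [cg pg] := gP y cy; have [w1 s1] := pp _ cg.
rewrite -{2}pg w1; split=> // i; have := s1 i.
rewrite pg => -[-> -> -> ->]; split=> //.
- case ex: e_op => [x'|] //=; rewrite pK //.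
  exact: component_e cg ex.
- case ex: f_op => [x'|] //=; rewrite pK //.
  exact: component_f cg ex.
Qed.

Definition no_inv i : rel letter := fun x y => ~~ (in_pos i x && in_neg i y).

Lemma has_inversionE i w :
  `[< has_inversion i w >] = ~~ pairwise (no_inv i) w.
Proof.
apply/asboolP/idP => [[w1 [w2 [w3 [x [y [-> px ny]]]]]]|].
  rewrite pairwise_cat /= all_cat /= /no_inv px ny /=.
  by rewrite !(andbF, andFb).
elim: w => //= a w IHw; rewrite negb_and => /orP [|/IHw].
  rewrite -has_predC => /hasP[y /= yw]; rewrite negbK => /andP[pa ny].
  have [w2 w3] := splitPr yw.
  by exists [::], w2, w3, a, y.
move=> [w1 [w2 [w3 [x [y [-> px ny]]]]]].
by exists (a :: w1), w2, w3, x, y.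
Qed.

Lemma no_inversion_cat i x y : pairwise (no_inv i) (x ++ y) =
  [&& ~~ (has (in_pos i) x && has (in_neg i) y),
      pairwise (no_inv i) x & pairwise (no_inv i) y].
Proof.
rewrite pairwise_cat; congr (_ && _).
apply/allrelP/idP => [h|].
  apply/negP => /andP[/hasP[a ax pa] /hasP[b yb nb]].
  by have := h _ _ ax yb; rewrite /no_inv pa nb.
move/negP=> h a b ax yb; apply/negP => /andP[pa nb]; apply: h.
by apply/andP; split; apply/hasP; [exists a|exists b].
Qed.

Lemma epsE i w : eps i w =
  if pairwise (no_inv i) w then ((count (in_neg i) w)%:Z)%:E else +oo%E.
Proof. by rewrite /eps has_inversionE; case: pairwise. Qed.

Lemma phiE i w : phi i w =
  if pairwise (no_inv i) w then ((count (in_pos i) w)%:Z)%:E else +oo%E.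
Proof. by rewrite /phi has_inversionE; case: pairwise. Qed.

Lemma e_opE i w : e_op i w =
  if pairwise (no_inv i) w && has (in_neg i) w
  then Some (replace_last (in_neg i) (e_letter i) w) else None.
Proof.
rewrite /e_op has_inversionE negbK epsE.
by case: pairwise => //=; rewrite lte_fin ltz_nat has_count.
Qed.

Lemma f_opE i w : f_op i w =
  if pairwise (no_inv i) w && has (in_pos i) w
  then Some (replace_first (in_pos i) (f_letter i) w) else None.
Proof.
rewrite /f_op has_inversionE negbK phiE.
by case: pairwise => //=; rewrite lte_fin ltz_nat has_count.
Qed.

Lemma replace_first_cat p g x y : replace_first p g (x ++ y) =
  if has p x then replace_first p g x ++ y else x ++ replace_first p g y.
Proof. by elim: x => //= a x ->; case: (p a) => //=; case: (has p x). Qed.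

Lemma replace_last_cat p g x y : replace_last p g (x ++ y) =
  if has p y then x ++ replace_last p g y else replace_last p g x ++ y.
Proof.
rewrite /replace_last rev_cat replace_first_cat has_rev.
by case: (has p y); rewrite rev_cat revK.
Qed.

Lemma size_replace_first p g x : size (replace_first p g x) = size x.
Proof. by elim: x => //= a x IHx; case: (p a) => //=; rewrite IHx. Qed.

Lemma size_replace_last p g x : size (replace_last p g x) = size x.
Proof. by rewrite size_rev size_replace_first size_rev. Qed.

Lemma size_component u x : component u x -> size x = size u.
Proof.
elim=> // i {}x y _ <-.
  by rewrite e_opE; case: ifP => // _ [<-]; rewrite size_replace_last.
by rewrite f_opE; case: ifP => // _ [<-]; rewrite size_replace_first.
Qed.

Lemma e_op_cat i x y : e_op i (x ++ y) =
  if pairwise (no_inv i) (x ++ y) then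
    if has (in_neg i) y then omap (cat x) (e_op i y)
    else omap (cat^~ y) (e_op i x)
  else None.
Proof.
rewrite !e_opE no_inversion_cat has_cat replace_last_cat.
case: (~~ _) => //=.
case: (pairwise _ x); case: (pairwise _ y); rewrite ?andbF ?andbT //=.
by case: (has (in_neg i) y); case: (has _ x).
Qed.

Lemma f_op_cat i x y : f_op i (x ++ y) =
  if pairwise (no_inv i) (x ++ y) then
    if has (in_pos i) x then omap (cat^~ y) (f_op i x)
    else omap (cat x) (f_op i y)
  else None.
Proof.
rewrite !f_opE no_inversion_cat has_cat replace_first_cat.
case: (~~ _) => //=.
case: (pairwise _ x); case: (pairwise _ y); rewrite ?andbF ?andbT //=.
by case: (has (in_pos i) x); case: (has _ y).
Qed.

Lemma component_cat u u' w : component (u ++ u') w ->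
  exists x x', [/\ component u x, component u' x' & w = x ++ x'].
Proof.
elim=> [|i _ z _ [x [x' [cx cx' ->]]]|i _ z _ [x [x' [cx cx' ->]]]].
- by exists u, u'; split=> //; apply: component_refl.
- rewrite e_op_cat; case: pairwise => //; case: has.
  + case ex: e_op => [y'|] //= [<-]; exists x, y'; split=> //.
    exact: component_e cx' ex.
  + case ex: e_op => [y|] //= [<-]; exists y, x'; split=> //.
    exact: component_e cx ex.
- rewrite f_op_cat; case: pairwise => //; case: has.
  + case ex: f_op => [y|] //= [<-]; exists y, x'; split=> //.
    exact: component_f cx ex.
  + case ex: f_op => [y'|] //= [<-]; exists x, y'; split=> //.
    exact: component_f cx' ex.
Qed.

Lemma eps_phi_eq i x y : eps i x = eps i y -> phi i x = phi i y ->
  pairwise (no_inv i) x = pairwise (no_inv i) y /\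
  (pairwise (no_inv i) y -> count (in_neg i) x = count (in_neg i) y /\
                            count (in_pos i) x = count (in_pos i) y).
Proof.
rewrite !epsE !phiE.
by case: (pairwise _ x); case: (pairwise _ y) => // -[->] [->].
Qed.

Lemma wt_cat x y : wt (x ++ y) = (wt x + wt y)%R.
Proof.
by rewrite /wt !count_cat !PoszD; congr (_, _); rewrite opprD addrACA.
Qed.

Lemma hypo_cong_cat u v u' v' :
  hypo_cong u v -> hypo_cong u' v' -> hypo_cong (u ++ u') (v ++ v').
Proof.
move=> [p [[pf pinj _] pu pp]] [q [[qf qinj _] qu qp]].
pose r (w : word) := p (take (size u) w) ++ q (drop (size u) w).
have rE x x' : size x = size u -> r (x ++ x') = p x ++ q x'.
  by move=> sx; rewrite /r take_size_cat // drop_size_cat.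
apply: (@hypo_cong_intro _ _ r) => [w z||w].
- move=> /set_mem/component_cat[x [x' [cx cx' ->]]].
  move=> /set_mem/component_cat[y [y' [cy cy' ->]]].
  rewrite !rE ?(size_component cx) ?(size_component cy) // => /eqP.
  rewrite eqseq_cat; last first.
    by rewrite (size_component (pf _ cx)) (size_component (pf _ cy)).
  move=> /andP[/eqP exy /eqP exy']; congr (_ ++ _).
    by apply: pinj => //; apply/mem_set.
  by apply: qinj => //; apply/mem_set.
- by rewrite rE // pu qu.
move=> /component_cat[x [x' [cx cx' ->]]]; rewrite rE ?(size_component cx) //.
have [wx sx] := pp x cx; have [wx' sx'] := qp x' cx'.
rewrite !wt_cat wx wx'; split=> // i.
have [ex fx eex ffx] := sx i; have [ex' fx' eex' ffx'] := sx' i.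
have [nx kx] := eps_phi_eq ex fx; have [nx' kx'] := eps_phi_eq ex' fx'.
have np : pairwise (no_inv i) (p x ++ q x') = pairwise (no_inv i) (x ++ x').
  rewrite !no_inversion_cat nx nx'.
  case hx: (pairwise _ x); case hx': (pairwise _ x'); rewrite ?andbF //.
  by rewrite !has_count (kx hx).2 (kx' hx').1.
rewrite !epsE !phiE e_op_cat f_op_cat np e_op_cat f_op_cat.
case ni: (pairwise _ (x ++ x')) => //.
move: ni; rewrite no_inversion_cat => /and3P[_ hx hx'].
have [n1 p1] := kx hx; have [n2 p2] := kx' hx'.
rewrite !count_cat n1 p1 n2 p2 !has_count n2 p1 eex eex' ffx ffx'.
split=> //; case: ifP => _.
- case ey: e_op => [y|] //=; rewrite rE //; exact: size_component cx.
- case ey: e_op => [y|] //=; rewrite rE //.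
  exact: size_component (component_e cx ey).
- case ey: f_op => [y|] //=; rewrite rE //.
  exact: size_component (component_f cx ey).
- case ey: f_op => [y|] //=; rewrite rE //; exact: size_component cx.
Qed.

Local Open Scope quotient_scope.

Definition hypo_rel : rel word := fun u v => `[< hypo_cong u v >].

Lemma hypo_rel_refl : reflexive hypo_rel.
Proof. by move=> u; apply/asboolP/hypo_cong_refl. Qed.

Lemma hypo_rel_sym : symmetric hypo_rel.
Proof.
by move=> u v; apply/asboolP/asboolP; apply: hypo_cong_sym.
Qed.

Lemma hypo_rel_trans : transitive hypo_rel.
Proof.
move=> v u w /asboolP uv /asboolP vw; apply/asboolP.
exact: hypo_cong_trans uv vw.
Qed.

Canonical hypo_equiv_rel :=
  EquivRel hypo_rel hypo_rel_refl hypo_rel_sym hypo_rel_trans.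

Definition hypoC2 : Type := {eq_quot hypo_rel}.

HB.instance Definition _ := Choice.on hypoC2.
HB.instance Definition _ := EqQuotient.on hypoC2.

Definition hypo_one : hypoC2 := \pi_hypoC2 ([::] : word).

Definition hypo_mul (a b : hypoC2) : hypoC2 :=
  \pi_hypoC2 (repr a ++ repr b).

Lemma hypo_piP (u v : word) :
  \pi_hypoC2 u = \pi_hypoC2 v <-> hypo_cong u v.
Proof.
split=> [/eqP|h]; first by rewrite eqquotE => /asboolP.
by apply/eqP; rewrite eqquotE; apply/asboolP.
Qed.

Lemma hypo_mul_pi (u v : word) :
  hypo_mul (\pi_hypoC2 u) (\pi_hypoC2 v) = \pi_hypoC2 (u ++ v).
Proof.
apply/hypo_piP/hypo_cong_cat.
- by apply/hypo_piP; rewrite reprK.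
- by apply/hypo_piP; rewrite reprK.
Qed.

Lemma hypo_pi_surj (a : hypoC2) : exists u : word, a = \pi_hypoC2 u.
Proof. by exists (repr a); rewrite reprK. Qed.

Lemma hypo_mulA : associative hypo_mul.
Proof.
move=> a b c; have [u ->] := hypo_pi_surj a; have [v ->] := hypo_pi_surj b.
by have [w ->] := hypo_pi_surj c; rewrite !hypo_mul_pi catA.
Qed.

Lemma hypo_1mul : left_id hypo_one hypo_mul.
Proof. by move=> a; have [u ->] := hypo_pi_surj a; rewrite hypo_mul_pi. Qed.

Lemma hypo_mul1 : right_id hypo_one hypo_mul.
Proof.
by move=> a; have [u ->] := hypo_pi_surj a; rewrite hypo_mul_pi cats0.
Qed.

HB.instance Definition _ :=
  isMonoid.Build hypoC2 hypo_mulA hypo_1mul hypo_mul1.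

(* Main.v *)
Require Import Defs.
From mathcomp Require Import all_boot.
From mathcomp Require Import all_algebra generic_quotient classical_sets functions.

Set Implicit Arguments.
Unset Strict Implicit.
Unset Printing Implicit Defensive.

(** Letters other than x and y can be erased.  To compare the numbers p < q of
    y's before the first x, map y to bar 2 and x to 1, so that no image word has
    a 1-inversion and f_1^(p+1) applies; it turns the first p+1 letters into
    (bar 1)^p 2 on one side, which creates a 2-inversion with a later bar 2, and
    into (bar 1)^(p+1) on the other, which creates none.  The letters after the
    last x are treated dually, with y mapped to 2, x to bar 1, and e_1. *)

(** * Invariants and operators under the hypoplactic congruence *)

Lemma hypo_cong_wt (a b : word) : hypo_cong a b -> wt a = wt b.
Proof.
by move=> [psi [_ <- pres]]; have [-> _] := pres a (component_refl a).
Qed.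

Lemma hypo_cong_eps (i : Defs.index) (a b : word) :
  hypo_cong a b -> eps i a = eps i b.
Proof.
move=> [psi [_ <- pres]].
by have [_ /(_ i) [-> _ _ _]] := pres a (component_refl a).
Qed.

Lemma component_trans (a b c : word) :
  component a b -> component b c -> component a c.
Proof.
move=> ab; elim=> // i x y _ ax xy.
  exact: component_e ax xy.
exact: component_f ax xy.
Qed.

(** The same [psi] is the witness: the component of [a'] lies inside that of [a], so injectivity and
    preservation restrict to it. *)
Lemma hypo_cong_component (a b a' : word) (psi : word -> word) :
  set_bij (component a) (component b) psi -> preserves_structure a psi ->
  component a a' -> hypo_cong a' (psi a').
Proof.
move=> [_ inj _] pres aa'.
apply: (@hypo_cong_intro _ _ psi) => // [x y /set_mem cx /set_mem cy|x cx].
  by apply: inj; apply/mem_set; apply: component_trans; eassumption.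
by apply: pres; apply: component_trans cx.
Qed.

(** Since [psi] commutes with [f_op], the word [b'] is [psi a']. *)
Lemma hypo_cong_f_op (i : Defs.index) (a b a' b' : word) : hypo_cong a b ->
  f_op i a = Some a' -> f_op i b = Some b' -> hypo_cong a' b'.
Proof.
move=> [psi [bij <- pres]] fa.
have [_ /(_ i) [_ _ _ ->]] := pres a (component_refl a).
rewrite fa => -[<-]; apply: hypo_cong_component bij pres _.
exact: component_f (component_refl a) fa.
Qed.

Lemma hypo_cong_e_op (i : Defs.index) (a b a' b' : word) : hypo_cong a b ->
  e_op i a = Some a' -> e_op i b = Some b' -> hypo_cong a' b'.
Proof.
move=> [psi [bij <- pres]] ea.
have [_ /(_ i) [_ _ -> _]] := pres a (component_refl a).
rewrite ea => -[<-]; apply: hypo_cong_component bij pres _.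
exact: component_e (component_refl a) ea.
Qed.

(** * Letter classes and words without inversions *)

Lemma in_posN (i : Defs.index) (x : letter) : in_pos i x -> ~~ in_neg i x.
Proof. by case: i; case: x. Qed.

Lemma in_negN (i : Defs.index) (x : letter) : in_neg i x -> ~~ in_pos i x.
Proof. by case: i; case: x. Qed.

Lemma in_neg_f_letter (i : Defs.index) (x : letter) :
  in_pos i x -> in_neg i (f_letter i x).
Proof. by case: i; case: x. Qed.

Lemma in_pos_e_letter (i : Defs.index) (x : letter) :
  in_neg i x -> in_pos i (e_letter i x).
Proof. by case: i; case: x. Qed.

Lemma pairwise_no_inv_hasN_pos (i : Defs.index) (w : word) :
  ~~ has (in_pos i) w -> pairwise (no_inv i) w.
Proof.
elim: w => //= a w IHw; rewrite negb_or => /andP[Na /IHw->].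
by rewrite andbT; apply/allP => b _; rewrite /no_inv (negbTE Na).
Qed.

Lemma pairwise_no_inv_hasN_neg (i : Defs.index) (w : word) :
  ~~ has (in_neg i) w -> pairwise (no_inv i) w.
Proof.
elim: w => //= a w IHw; rewrite negb_or => /andP[_ Nw].
rewrite IHw // andbT; apply/allP => b bw.
by rewrite /no_inv negb_and (hasPn Nw) ?orbT.
Qed.

Lemma hasN_pos_map_f (i : Defs.index) (s : word) :
  all (in_pos i) s -> ~~ has (in_pos i) (map (f_letter i) s).
Proof.
move=> /allP ps; rewrite has_map; apply/hasPn => x /ps px /=.
exact/in_negN/in_neg_f_letter.
Qed.

Lemma hasN_neg_map_e (i : Defs.index) (s : word) :
  all (in_neg i) s -> ~~ has (in_neg i) (map (e_letter i) s).
Proof.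
move=> /allP ns; rewrite has_map; apply/hasPn => x /ns nx /=.
exact/in_posN/in_pos_e_letter.
Qed.

(** * Iterated operators on words without inversions *)

(** The letters already changed are in [in_neg i] and precede all those in [in_pos i], so there is
    no inversion and [a] is the left-most letter to replace. *)
Lemma f_op_map_f_cat (i : Defs.index) (s t : word) (a : letter) :
  all (in_pos i) (s ++ a :: t) ->
  f_op i (map (f_letter i) s ++ a :: t) =
    Some (map (f_letter i) s ++ f_letter i a :: t).
Proof.
rewrite all_cat => /andP[/hasN_pos_map_f Ns pat].
have Nat : ~~ has (in_neg i) (a :: t).
  by apply/hasPn => x /(allP pat)/in_posN.
have pa : in_pos i a by case/andP: pat.
rewrite f_opE no_inversion_cat (pairwise_no_inv_hasN_pos Ns).
rewrite (pairwise_no_inv_hasN_neg Nat) replace_first_cat has_cat (negbTE Ns).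
by rewrite /= pa.
Qed.

Lemma e_op_cat_map_e (i : Defs.index) (s t : word) (a : letter) :
  all (in_neg i) (rcons s a ++ t) ->
  e_op i (rcons s a ++ map (e_letter i) t) =
    Some (s ++ e_letter i a :: map (e_letter i) t).
Proof.
rewrite all_cat => /andP[nsa /hasN_neg_map_e Nt].
have Nsa : ~~ has (in_pos i) (rcons s a).
  by apply/hasPn => x /(allP nsa)/in_negN.
have na : in_neg i a by apply: (allP nsa); rewrite mem_rcons mem_head.
rewrite e_opE no_inversion_cat (pairwise_no_inv_hasN_pos Nsa).
rewrite (pairwise_no_inv_hasN_neg Nt) replace_last_cat has_cat (negbTE Nt).
rewrite (negbTE Nsa) has_rcons na /= -cats1 replace_last_cat /= na /=.
by rewrite /replace_last /= na -catA.
Qed.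

(** Equal sizes mean that the operator is applied equally often on both sides. It works from the
    left, so the induction removes the last letter of the prefix. *)
Lemma hypo_cong_map_f (i : Defs.index) (s t s' t' : word) : size s = size s' ->
  all (in_pos i) (s ++ t) -> all (in_pos i) (s' ++ t') ->
  hypo_cong (s ++ t) (s' ++ t') ->
  hypo_cong (map (f_letter i) s ++ t) (map (f_letter i) s' ++ t').
Proof.
elim/last_ind: s s' t t' => [|s a IHs] s' t t'; case/lastP: s' => [|s' a'] //;
  rewrite !size_rcons // => -[ss'].
rewrite !cat_rcons !map_rcons !cat_rcons => ps ps' cong.
by apply: (hypo_cong_f_op (IHs _ _ _ ss' ps ps' cong)); apply: f_op_map_f_cat.
Qed.

(** Here the operator works from the right, so the first letter of the suffix is changed last. *)
Lemma hypo_cong_map_e (i : Defs.index) (s t s' t' : word) : size t = size t' ->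
  all (in_neg i) (s ++ t) -> all (in_neg i) (s' ++ t') ->
  hypo_cong (s ++ t) (s' ++ t') ->
  hypo_cong (s ++ map (e_letter i) t) (s' ++ map (e_letter i) t').
Proof.
elim: t t' s s' => [|a t IHt] [|a' t'] s s' //= [tt'].
rewrite -!(cat_rcons a) -!(cat_rcons a') => ns ns' cong.
have := hypo_cong_e_op (IHt _ _ _ tt' ns ns' cong).
by apply; apply: e_op_cat_map_e.
Qed.

(** * Comparison of the outer blocks of congruent words *)

Lemma hypo_cong_prefix_leq (p q : nat) (t t' : word) :
  all (in_pos i1) t -> all (in_pos i1) t' ->
  hypo_cong (nseq p lb2 ++ l1 :: t) (nseq q lb2 ++ l1 :: t') -> q <= p.
Proof.
have count_l2 (w : word) : all (in_pos i1) w -> count_mem l2 w = 0.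
  by move=> pw; apply/count_memPn/negP => /(allP pw).
move=> pt pt' cong; rewrite leqNgt; apply/negP => ltpq.
(* Neither word contains [l2], so equal weights give equal numbers of [lb2]; as [p < q], some of
   them on the left must lie in [t]. *)
have t_lb2 : lb2 \in t.
  have := congr1 snd (hypo_cong_wt cong).
  rewrite /= !count_cat /= !count_nseq /= !count_l2 //.
  rewrite !mul0n !mul1n !GRing.sub0r.
  move=> /GRing.oppr_inj [] e; rewrite -has_pred1 has_count.
  by rewrite -(ltn_add2l p) addn0 e ltn_addr.
(* Both prefixes have length [p.+1]: the left one reaches [l1], the right one stays inside the block
   of [lb2]. *)
have /(hypo_cong_eps i2) :
    hypo_cong (map (f_letter i1) (nseq p lb2 ++ [:: l1]) ++ t)
      (map (f_letter i1) (nseq p.+1 lb2) ++ nseq (q - p.+1) lb2 ++ l1 :: t').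
  apply: hypo_cong_map_f.
  - by rewrite size_cat !size_nseq addn1.
  - by rewrite !all_cat !all_nseq /= pt !orbT.
  - by rewrite !all_cat !all_nseq /= pt' !orbT.
  - by rewrite -(catA (nseq p lb2)) (catA (nseq p.+1 lb2)) -nseqD subnKC.
(* The right word has no [l2], so its [eps i2] is finite. *)
rewrite !epsE (@pairwise_no_inv_hasN_pos _ (_ ++ (_ ++ _))); last first.
  rewrite !has_cat map_nseq !has_nseq /= !andbF /=.
  by apply/hasPn => -[] // /(allP pt').
(* On the left, the [l2] obtained from [l1] precedes the [lb2] in [t], so [eps i2] is infinite. *)
rewrite map_cat no_inversion_cat has_cat orbT /=.
by have -> : has (in_neg i2) t by apply/hasP; exists lb2.
Qed.

Lemma hypo_cong_suffix_leq (p q : nat) (t t' : word) :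
  all (in_neg i1) t -> all (in_neg i1) t' ->
  hypo_cong (t ++ lb1 :: nseq p l2) (t' ++ lb1 :: nseq q l2) -> q <= p.
Proof.
have count_lb2 (w : word) : all (in_neg i1) w -> count_mem lb2 w = 0.
  by move=> nw; apply/count_memPn/negP => /(allP nw).
move=> nt nt' cong; rewrite leqNgt; apply/negP => ltpq.
have t_l2 : l2 \in t.
  have := congr1 snd (hypo_cong_wt cong).
  rewrite /= !count_cat /= !count_nseq /= !count_lb2 //.
  rewrite !mul0n !mul1n !GRing.subr0.
  move=> -[] e; rewrite -has_pred1 has_count.
  by rewrite -(ltn_add2r p) add0n e ltn_addl.
(* After [p.+1] steps the left [lb1] has become [lb2], to the right of the [l2] in [t]; the right
   word still has no [lb2]. *)
have /(hypo_cong_eps i2) :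
    hypo_cong (t ++ map (e_letter i1) (lb1 :: nseq p l2))
      ((t' ++ lb1 :: nseq (q - p.+1) l2) ++ map (e_letter i1) (nseq p.+1 l2)).
  apply: hypo_cong_map_e.
  - by rewrite /= !size_nseq.
  - by rewrite !all_cat /= !all_nseq /= nt !orbT.
  - by rewrite !all_cat /= !all_nseq /= nt' !orbT.
  - by rewrite -catA cat_cons -nseqD subnK.
rewrite !epsE (@pairwise_no_inv_hasN_neg _ ((_ ++ _) ++ _)); last first.
  rewrite !has_cat map_nseq /= !has_nseq /= !andbF /= !orbF.
  by apply/hasPn => -[] // /(allP nt').
rewrite no_inversion_cat /= andbT.
by have -> : has (in_pos i2) t by apply/hasP; exists l2.
Qed.

(** * From identities to congruences between words *)

(** Renaming letters, with those sent to [None] erased, is a morphism of free monoids; its composite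
    with the projection is a morphism to which the identity applies. *)
Lemma satisfies_hypo_cong_pmap (X : finType) (u v : seq X)
    (g : X -> option letter) :
  satisfies_identity hypoC2 u v ->
  hypo_cong (pmap g u) (pmap g v).
Proof.
move=> huv; apply/hypo_piP; apply: (huv (fun w => (\pi_hypoC2 (pmap g w))%qT)).
by split=> // a b; rewrite pmap_cat -hypo_mul_pi.
Qed.

Lemma satisfies_count_mem (X : finType) (u v : seq X) (x : X) :
  satisfies_identity hypoC2 u v -> count_mem x u = count_mem x v.
Proof.
(* With [x] sent to [l1] and all else erased, the first weight coordinate counts [x]. *)
pose g z := if z == x then Some l1 else None; move=> huv.
have count_l1 w : count_mem l1 (pmap g w) = count_mem x w
  by elim: w => //= z w <-; rewrite /g; case: eqP.
have count_lb1 w : count_mem lb1 (pmap g w) = 0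
  by elim: w => //= z w <-; rewrite /g; case: eqP.
have := hypo_cong_wt (satisfies_hypo_cong_pmap g huv).
by move=> /(congr1 fst); rewrite /= !count_l1 !count_lb1 !GRing.subr0 => -[].
Qed.

(** The test for [x] comes first, so the case [y = x] fits the same argument, with an empty block of
    [b]. *)
Definition two_letters {X : eqType} (x y : X) (a b : letter) (z : X) :
    option letter :=
  if z == x then Some a else if z == y then Some b else None.

Lemma two_lettersx {X : eqType} (x y : X) (a b : letter) :
  two_letters x y a b x = Some a.
Proof. by rewrite /two_letters eqxx. Qed.

Lemma pmap_two_letters (X : eqType) (x y : X) (a b : letter) (w : seq X) :
  count_mem x w = 0 ->
  pmap (two_letters x y a b) w = nseq (count_mem y w) b.
Proof.
elim: w => //= z w IHw; rewrite /two_letters; case: (z == x) => //= /IHw.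
by case: (z == y) => /= <-.
Qed.

Lemma all_pmap_two_letters {X : eqType} (x y : X) (a b : letter) (P : pred letter)
    (w : seq X) :
  P a -> P b -> all P (pmap (two_letters x y a b) w).
Proof.
move=> Pa Pb; elim: w => //= z w IHw; rewrite /two_letters.
by case: (z == x) => /=; [rewrite Pa|case: (z == y); rewrite //= Pb].
Qed.

Theorem theorem9p31 (X : finType) (u v : seq X)
  (huv : satisfies_identity hypoC2 u v) :
  [/\ forall x : X, count_mem x u = count_mem x v,
      forall (x : X) (u1 u2 v1 v2 : seq X),
        u = u1 ++ x :: u2 -> v = v1 ++ x :: v2 ->
        count_mem x u1 = 0 -> count_mem x v1 = 0 ->
        forall y : X, count_mem y u1 = count_mem y v1 &
      forall (x : X) (u1 u2 v1 v2 : seq X),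
        u = u1 ++ x :: u2 -> v = v1 ++ x :: v2 ->
        count_mem x u2 = 0 -> count_mem x v2 = 0 ->
        forall y : X, count_mem y u2 = count_mem y v2].
Proof.
split=> [x|x u1 u2 v1 v2 Eu Ev u1x v1x y|x u1 u2 v1 v2 Eu Ev u2x v2x y].
- exact: satisfies_count_mem.
- have := satisfies_hypo_cong_pmap (two_letters x y l1 lb2) huv.
  rewrite Eu Ev !pmap_cat /= two_lettersx /=.
  rewrite !(pmap_two_letters _ _ _ u1x, pmap_two_letters _ _ _ v1x) => cong.
  (* Each use of the block comparison gives one inequality; symmetry of the congruence gives the
     other. *)
  apply/eqP; rewrite eqn_leq; apply/andP; split.
    apply: (hypo_cong_prefix_leq _ _ (hypo_cong_sym cong));
      exact: all_pmap_two_letters.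
  by apply: (hypo_cong_prefix_leq _ _ cong); apply: all_pmap_two_letters.
- have := satisfies_hypo_cong_pmap (two_letters x y lb1 l2) huv.
  rewrite Eu Ev !pmap_cat /= two_lettersx /=.
  rewrite !(pmap_two_letters _ _ _ u2x, pmap_two_letters _ _ _ v2x) => cong.
  apply/eqP; rewrite eqn_leq; apply/andP; split.
    apply: (hypo_cong_suffix_leq _ _ (hypo_cong_sym cong));
      exact: all_pmap_two_letters.
  by apply: (hypo_cong_suffix_leq _ _ cong); apply: all_pmap_two_letters.
Qed.
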